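(* $z_L(5,5)\ge 15$.
   Context: **Classical Zarankiewicz number.** For $m\ge n\ge 2$, $z(m,n)$ is the maximum number of edges in a bipartite graph with parts $S=[m]=\{1,\dots,m\}$ and $T=[n]=\{1,\dots,n\}$ that contains no $K_{2,2}$ (equivalently, no cycle $C_4$). **Limited augmented bipartite graphs.** Let $G_1=(S,T,E_1)$ with $S=[m]$, $T=[n]$ be a $C_4$-free bipartite graph with $|E_1|=z(m,n)$. A limited augmented bipartite graph $G=(S,T,E_1\cup E_2)$ augmented from $G_1$ consists of the set $E_1$ of 1-edges (pairs, or ''cells'', $(i,j)\in S\times T$) and a set $E_2$ of 2-edges. A 2-edge is a quadruple $(i,j;k,l)$ with $i,k\in S$, $j,l\in T$, where the case $i=k$ and $j=l$ is forbidden; it is regarded as an unordered pair of the two distinct cells $(i,j)$ and $(k,l)$, called its halves. It is nondegenerate if $i\ne k$ and $j\ne l$, row-degenerate if $i=k$ and $j\neq l$, and column-degenerate if $i\ne k$ and $j=l$. The simplicity condition is imposed: no 2-edge shares a cell with any 1-edge or with another 2-edge. **Generalized $C_4$-cycles.** A cell $(i,j)$ is occupied if $(i,j)\in E_1$ or $(i,j)$ is a half of some 2-edge in $E_2$. The graph $G$ contains a generalized $C_4$-cycle if any of the following holds: 1. There is a classical $C_4$-cycle formed by 1-edges. 2. There is a nondegenerate 2-edge $(i,j;k,l)\in E_2$ such that both cells $(i,l)$ and $(k,j)$ are occupied. 3. There are a 2-edge $(i,j;p,q)\in E_2$ (of any type) and a cell $(k,l)$ with $k\notin\{i,p\}$ and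 $l\notin\{j,q\}$ such that the five cells $(k,l),(k,j),(k,q),(i,l),(p,l)$ are all occupied; if the 2-edge is nondegenerate, these five cells must moreover be pairwise distinct. **Limited augmented Zarankiewicz number.** $z_L(m,n)$ is the maximum of $|E_1|+|E_2|$ over all $m\times n$ limited augmented bipartite graphs $G=(S,T,E_1\cup E_2)$ (augmented from a $C_4$-free graph with $|E_1|=z(m,n)$, satisfying the simplicity condition) that contain no generalized $C_4$-cycle. *)

(* Defs.v *)
From mathcomp Require Import all_boot.

Set Implicit Arguments.
Unset Strict Implicit.
Unset Printing Implicit Defensive.

Section Zarankiewicz.
Variables m n : nat.

Local Notation cell := ('I_m * 'I_n)%type.

Definition has_C4 (E : {set cell}) : bool :=
  [exists i : 'I_m, exists k : 'I_m, exists j : 'I_n, exists l : 'I_n,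
    [&& i != k, j != l,
        (i, j) \in E, (i, l) \in E, (k, j) \in E & (k, l) \in E]].

Definition zarankiewicz : nat :=
  \max_(E : {set cell} | ~~ has_C4 E) #|E|.

(* A 2-edge (i,j;k,l) is encoded as the unordered pair of its halves, the set
   [set (i, j); (k, l)] of cardinal 2. *)
Definition two_edge (e : {set cell}) : bool := #|e| == 2.

Definition simple_aug (E1 : {set cell}) (E2 : {set {set cell}}) : bool :=
  [forall e in E2, [disjoint e & E1]] &&
  [forall e in E2, forall f in E2, (e != f) ==> [disjoint e & f]].

Definition limited_aug (E1 : {set cell}) (E2 : {set {set cell}}) : bool :=
  [&& ~~ has_C4 E1, #|E1| == zarankiewicz,
      [forall e in E2, two_edge e] & simple_aug E1 E2].

Definition occupied (E1 : {set cell}) (E2 : {set {set cell}}) (c : cell) :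
    bool :=
  (c \in E1) || [exists e in E2, c \in e].

Definition gen_C4_nondegenerate (E1 : {set cell}) (E2 : {set {set cell}}) :
    bool :=
  [exists i : 'I_m, exists j : 'I_n, exists k : 'I_m, exists l : 'I_n,
    [&& [set (i, j); (k, l)] \in E2, i != k, j != l,
        occupied E1 E2 (i, l) & occupied E1 E2 (k, j)]].

Definition gen_C4_five_cells (E1 : {set cell}) (E2 : {set {set cell}}) :
    bool :=
  [exists i : 'I_m, exists j : 'I_n, exists p : 'I_m, exists q : 'I_n,
   exists k : 'I_m, exists l : 'I_n,
    let cs : seq cell := [:: (k, l); (k, j); (k, q); (i, l); (p, l)] in
    [&& [set (i, j); (p, q)] \in E2,
        k \notin [:: i; p], l \notin [:: j; q],
        all (occupied E1 E2) cs &
        (i != p) && (j != q) ==> uniq cs]].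

Definition has_gen_C4 (E1 : {set cell}) (E2 : {set {set cell}}) : bool :=
  [|| has_C4 E1, gen_C4_nondegenerate E1 E2 | gen_C4_five_cells E1 E2].

Definition limited_zarankiewicz : nat :=
  \max_(G : {set cell} * {set {set cell}} |
          limited_aug G.1 G.2 && ~~ has_gen_C4 G.1 G.2)
     (#|G.1| + #|G.2|).

End Zarankiewicz.

(* Main.v *)
Require Import Defs.
From mathcomp Require Import all_boot.

(** The bound is attained by an explicit grid: the cells marked [1] are the
    1-edges, two cells bearing the same letter are the halves of a 2-edge, and
    the cells marked with a dot are empty.
<<
         0 1 2 3 4
      0  1 1 a . .
      1  1 b 1 . .
      2  c 1 . 1 b
      3  1 . c 1 1
      4  . 1 1 a 1
>>
    That gives 12 1-edges and three 2-edges, 15 in all, on pairwise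
    disjoint sets of cells.  Two things need proof.

    The first is that the 1-edges are admissible: a limited augmented graph
    must start from a C4-free graph with as many edges as possible, so
    [z(5,5) = 12] is needed.  In a C4-free graph two distinct rows share at
    most one column, so a pair of columns lies in at most one row; hence
    [\sum_i 'C(r_i, 2) <= 'C(5, 2) = 10] for the row degrees [r_i].  The chord
    of the convex function [r |-> 'C(r, 2)] through [r = 2] and [r = 3] gives
    [2 r <= 'C(r, 2) + 3] for every natural [r]; summing over the five rows,
    [2 |E| <= 10 + 15], so [|E| <= 12] ([z55_upper]).

    The second is that the grid has no generalized C4-cycle.  Listing the
    2-edges in both orientations turns the conditions that forbid such a cycle
    into finitely many membership tests in explicit lists, which are decided by
    computation ([not_nondegenerateP], [not_five_cellsP]). *)

Set Implicit Arguments.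
Unset Strict Implicit.
Unset Printing Implicit Defensive.

(** * The upper bound for the classical Zarankiewicz number *)

Section DoubleCounting.
Variables m n : nat.
Implicit Type E : {set 'I_m * 'I_n}.

Definition row_nbh E (i : 'I_m) : {set 'I_n} := [set j | (i, j) \in E].

Lemma card_edges_by_rows E : #|E| = \sum_i #|row_nbh E i|.
Proof.
rewrite -sum1_card (eq_bigl (fun c => xpredT c.1 && (c.2 \in row_nbh E c.1))).
  rewrite -(pair_big_dep xpredT (fun i j => j \in row_nbh E i) (fun _ _ => 1)).
  by apply: eq_bigr => i _; rewrite sum1_card.
by case=> i j; rewrite /= inE.
Qed.

(** Both sides count pairs of columns: the left-hand side counts a pair once
    for each row that contains it, and a pair contained in two rows would be
    a C4. *)
Lemma C4_free_sum_bin2 E :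
  ~~ has_C4 E -> \sum_i 'C(#|row_nbh E i|, 2) <= 'C(n, 2).
Proof.
move=> noC4; pose D i := [set A : {set 'I_n} | A \subset row_nbh E i & #|A| == 2].
have -> : \sum_i 'C(#|row_nbh E i|, 2) = \sum_i \sum_(A in D i) 1.
  by apply: eq_bigr => i _; rewrite sum1_card cards_draws.
rewrite (exchange_big_dep (fun A : {set 'I_n} => #|A| == 2)) /=; last first.
  by move=> i A _; rewrite inE => /andP[].
rewrite -[n in 'C(n, 2)]card_ord -card_draws -sum1_card.
rewrite [leqRHS](eq_bigl (fun A : {set 'I_n} => #|A| == 2)); last first.
  by move=> A; rewrite inE.
apply: leq_sum => A cardA; rewrite sum1_card; apply/card_le1_eqP => i k.
rewrite -[i \in _]/(A \in D i) -[k \in _]/(A \in D k) !inE.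
move=> /andP[/subsetP sAi _] /andP[/subsetP sAk _].
apply/eqP/negPn/negP => neq_ik; case/negP: noC4.
have [j [l [neq_jl defA]]] := cards2P _ cardA.
have [Aj Al] : j \in A /\ l \in A by rewrite defA !inE !eqxx orbT.
apply/existsP; exists i; apply/existsP; exists k.
apply/existsP; exists j; apply/existsP; exists l.
move: (sAi _ Aj) (sAi _ Al) (sAk _ Aj) (sAk _ Al).
by rewrite !inE eq_sym neq_ik neq_jl => -> -> -> ->.
Qed.

End DoubleCounting.

(** The chord of [r |-> 'C(r, 2)] between 2 and 3, which is tight for the
    degree sequence [3, 3, 2, 2, 2]. *)
Lemma bin2_chord r : r.*2 <= 'C(r, 2) + 3.
Proof.
case: r => [|[|r]] //; elim: r => [|r IHr] //.
rewrite doubleS binS bin1 -addn2 addnAC.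
by apply: leq_add.
Qed.

Lemma z55_upper (E : {set 'I_5 * 'I_5}) : ~~ has_C4 E -> #|E| <= 12.
Proof.
move=> /C4_free_sum_bin2 le10.
rewrite -ltnS -ltn_double -[_ < _]/(_ <= 25) card_edges_by_rows -mul2n big_distrr.
apply: (@leq_trans (\sum_i ('C(#|row_nbh E i|, 2) + 3))).
  by apply: leq_sum => i _; rewrite /= mul2n bin2_chord.
by rewrite big_split sum_nat_const card_ord (leq_add le10).
Qed.

(** * Augmented graphs given by lists *)

Lemma set2_eq_cases (T : finType) (a b c d : T) :
  [set a; b] = [set c; d] -> (a, b) = (c, d) \/ (a, b) = (d, c).
Proof.
move=> eqS; have: a \in [set c; d] by rewrite -eqS set21.
have: b \in [set c; d] by rewrite -eqS set22.
have: c \in [set a; b] by rewrite eqS set21.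
have: d \in [set a; b] by rewrite eqS set22.
by rewrite !inE; do 4![case/orP=> /eqP ?]; subst; auto.
Qed.

Section ListGraphs.
Variables m n : nat.
Local Notation cell := ('I_m * 'I_n)%type.
Implicit Types (ones : seq cell) (twos : seq (cell * cell)).

Definition halves (p : cell * cell) : seq cell := [:: p.1; p.2].

Definition one_edges ones : {set cell} := [set c in ones].

Definition two_edges twos : {set {set cell}} :=
  [set [set p.1; p.2] | p in twos].

Definition orientations twos : seq (cell * cell) :=
  twos ++ [seq (p.2, p.1) | p <- twos].

Definition occupied_cells ones twos : seq cell :=
  ones ++ flatten (map halves twos).

(** A decidable form of the simplicity condition.  As two distinct listed pairs
    have no cell in common, they also give distinct 2-edges, so the length of
    the list counts the 2-edges ([card_two_edges]). *)
Definition simple_lists ones twos : bool :=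
  all (fun p => [&& p.1 != p.2, p.1 \notin ones, p.2 \notin ones &
    all (fun q => (p != q) ==> ~~ has (mem (halves q)) (halves p)) twos]) twos.

Lemma occupied_cellsP ones twos c :
  occupied (one_edges ones) (two_edges twos) c =
  (c \in occupied_cells ones twos).
Proof.
rewrite /occupied /occupied_cells mem_cat inE; congr orb.
apply/exists_inP/flatten_mapP => [[_ /imsetP[p tp ->]] | [p tp]].
  by rewrite in_set2 => c_p; exists p; rewrite // !inE.
rewrite !inE => c_p; exists [set p.1; p.2]; last by rewrite in_set2.
exact: imset_f.
Qed.

Lemma mem_two_edges twos (a b : cell) :
  [set a; b] \in two_edges twos -> (a, b) \in orientations twos.
Proof.
case/imsetP=> -[c d] tp /set2_eq_cases; rewrite mem_cat => -[] ->.
  by rewrite tp.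
by apply/orP; right; apply/mapP; exists (c, d).
Qed.

Lemma disjoint_set2 (T : finType) (a b : T) (A : {set T}) :
  [disjoint [set a; b] & A] = (a \notin A) && (b \notin A).
Proof. by rewrite -setI_eq0 setIUl setU_eq0 !setI_eq0 !disjoints1. Qed.

Lemma simple_lists_disjoint ones twos p q :
    simple_lists ones twos -> p \in twos -> q \in twos -> p != q ->
  [disjoint [set p.1; p.2] & [set q.1; q.2]].
Proof.
move=> /allP ok /ok/and4P[_ _ _ /allP okp] /okp/implyP okpq /okpq.
by rewrite disjoint_set2 /= !inE orbF negb_or.
Qed.

Lemma simple_listsP ones twos : simple_lists ones twos ->
  [forall e in two_edges twos, two_edge e] &&
  simple_aug (one_edges ones) (two_edges twos).
Proof.
move=> simple; apply/and3P; split.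
- apply/forall_inP=> _ /imsetP[p tp ->].
  by have /and4P[neq _ _ _] := allP simple p tp; rewrite /two_edge cards2 neq.
- apply/forall_inP=> _ /imsetP[p tp ->].
  have /and4P[_ N1 N2 _] := allP simple p tp.
  by rewrite disjoint_set2 !inE N1.
apply/forall_inP=> _ /imsetP[p tp ->]; apply/forall_inP=> _ /imsetP[q tq ->].
apply/implyP=> neq; apply: simple_lists_disjoint (simple) tp tq _.
by apply: contra neq => /eqP ->.
Qed.

Lemma card_two_edges ones twos :
  simple_lists ones twos -> uniq twos -> #|two_edges twos| = size twos.
Proof.
move=> simple uniq_t; rewrite card_in_imset; first exact/card_uniqP.
move=> p q tp tq eq_pq; apply/eqP/negPn/negP=> neq.
have := simple_lists_disjoint simple tp tq neq.
by rewrite -eq_pq disjoint_set2 !inE eqxx.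
Qed.

(** The quantifiers over rows and columns only matter through the 2-edge that
    they name.  Both orientations are listed because the condition names the
    halves of an unordered pair in an order. *)
Lemma not_nondegenerateP ones twos :
    all (fun e : cell * cell => let: ((i, j), (k, l)) := e in
      ~~ [&& i != k, j != l, (i, l) \in occupied_cells ones twos
           & (k, j) \in occupied_cells ones twos]) (orientations twos) ->
  ~~ gen_C4_nondegenerate (one_edges ones) (two_edges twos).
Proof.
move=> /allP ok; apply/existsP => -[i /existsP[j /existsP[k /existsP[l]]]].
by rewrite !occupied_cellsP => /andP[/mem_two_edges/ok/negP].
Qed.

(** The corner [(k, l)] opposite the 2-edge is itself required to be occupied,
    so it ranges over an explicit list too. *)
Lemma not_five_cellsP ones twos :
    all (fun e : cell * cell => let: ((i, j), (p, q)) := e in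
      all (fun c : cell => let: (k, l) := c in
        ~~ [&& k \notin [:: i; p], l \notin [:: j; q] &
             all (mem (occupied_cells ones twos))
                 [:: (k, j); (k, q); (i, l); (p, l)]])
      (occupied_cells ones twos)) (orientations twos) ->
  ~~ gen_C4_five_cells (one_edges ones) (two_edges twos).
Proof.
move=> /allP ok; apply/existsP => -[i /existsP[j /existsP[p /existsP[q]]]].
case/existsP=> k /existsP[l] /and5P[/mem_two_edges/ok/allP ok_e kN lN].
rewrite (eq_all (occupied_cellsP ones twos)) => /andP[/ok_e/negP bad occ] _.
by apply: bad; rewrite kN lN.
Qed.

Lemma not_has_C4P ones :
    all (fun a : cell => all (fun b : cell =>
      ~~ [&& a.1 != b.1, a.2 != b.2, (a.1, b.2) \in ones
           & (b.1, a.2) \in ones]) ones) ones ->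
  ~~ has_C4 (one_edges ones).
Proof.
move=> /allP ok; apply/existsP => -[i /existsP[k /existsP[j /existsP[l]]]].
rewrite !inE => /and5P[neq_ik neq_jl /ok/allP ok_a il /andP[kj /ok_a/negP]].
by case; rewrite /= neq_ik neq_jl il.
Qed.

End ListGraphs.

(** * The grid *)

(** The ordinals are built from closed proofs, rather than with [inord], so
    that the membership tests below evaluate. *)
Definition o0 : 'I_5 := @Ordinal 5 0 isT.
Definition o1 : 'I_5 := @Ordinal 5 1 isT.
Definition o2 : 'I_5 := @Ordinal 5 2 isT.
Definition o3 : 'I_5 := @Ordinal 5 3 isT.
Definition o4 : 'I_5 := @Ordinal 5 4 isT.

Definition grid_ones : seq ('I_5 * 'I_5) :=
  [:: (o0, o0); (o0, o1); (o1, o0); (o1, o2); (o2, o1); (o2, o3);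
      (o3, o0); (o3, o3); (o3, o4); (o4, o1); (o4, o2); (o4, o4)].

Definition grid_twos : seq (('I_5 * 'I_5) * ('I_5 * 'I_5)) :=
  [:: ((o0, o2), (o4, o3)); ((o1, o1), (o2, o4)); ((o2, o0), (o3, o2))].

Lemma grid_C4_free : ~~ has_C4 (one_edges grid_ones).
Proof. by apply: not_has_C4P; vm_compute. Qed.

Lemma card_grid_ones : #|one_edges grid_ones| = 12.
Proof. by rewrite cardsE; apply/card_uniqP. Qed.

Lemma z55 : zarankiewicz 5 5 = 12.
Proof.
apply/eqP; rewrite eqn_leq; apply/andP; split.
  by apply/bigmax_leqP => E; exact: z55_upper.
rewrite -card_grid_ones.
exact: (leq_bigmax_cond (F := fun E : {set _} => #|E|) _ grid_C4_free).
Qed.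

Theorem theorem4p6 : (15 <= limited_zarankiewicz 5 5)%N.
Proof.
have simple : simple_lists grid_ones grid_twos by vm_compute.
have card2 : #|two_edges grid_twos| = 3 by rewrite (card_two_edges simple).
apply: (bigmax_sup (one_edges grid_ones, two_edges grid_twos)) => /=; last first.
  by rewrite card_grid_ones card2.
rewrite /limited_aug /has_gen_C4 z55 card_grid_ones eqxx grid_C4_free.
rewrite (simple_listsP simple) !negb_or grid_C4_free /=.
apply/andP; split.
  by apply: not_nondegenerateP; vm_compute.
by apply: not_five_cellsP; vm_compute.
Qed.
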